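(* Let $n,m,p,q\in\mathbb{N}^*$, $d\in\mathbb{N}$, and for $(i,j)\in\{1,\dots,p\}\times\{1,\dots,q\}$ let $n_{i,j},m_{i,j}\in\mathbb{N}^*$ and $g_{i,j}\in\mathbb{N}$ be such that $n_{i,j}=n_{i,k}$ for all $i,j,k$ and $\sum_{\alpha=1}^p n_{\alpha,k}=n$ for all $k$, and $m_{i,k}=m_{j,k}$ for all $i,j,k$ and $\sum_{\beta=1}^q m_{j,\beta}=m$ for all $j$. Let $$\mathfrak{R}:=\left(\mathbb{R}^{n_{1,1}\times m_{1,1}}\right)^{g_{1,1}+1}\times\cdots\times\left(\mathbb{R}^{n_{p,q}\times m_{p,q}}\right)^{g_{p,q}+1}.$$ The set $$\left\{P\in\mathfrak{R}\;\middle|\;\forall\,\lambda\in\overline{\mathbb{C}}_+:\ \operatorname{rk}_{\mathbb{C}}\widehat{P}(\lambda)\geq d\right\}$$ is generic if, and only if, $$d\leq\min\{n,m\}\quad\wedge\quad\Big[\neg(d=n=m)\ \vee\ \big(\forall\,i\in\{1,\dots,p\}\ \forall\,j\in\{1,\dots,q\}:\ g_{i,j}=0\big)\Big].$$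
   Context: $\mathbb{N}=\{0,1,2,\dots\}$, $\mathbb{N}^*=\{1,2,\dots\}$, $\overline{\mathbb{C}}_+=\{z\in\mathbb{C}\mid \operatorname{Re}z\geq 0\}$. For $P=\big((P^{1,1}_0,\dots,P^{1,1}_{g_{1,1}}),\dots,(P^{p,q}_0,\dots,P^{p,q}_{g_{p,q}})\big)\in\mathfrak{R}$ put $P^{i,j}(x):=\sum_{k=0}^{g_{i,j}}P^{i,j}_kx^k\in\mathbb{R}[x]^{n_{i,j}\times m_{i,j}}$ and let $\widehat{P}(x)=[P^{i,j}(x)]_{i=1,\dots,p;\,j=1,\dots,q}\in\mathbb{R}[x]^{n\times m}$ be the resulting block matrix; $\widehat{P}(\lambda)\in\mathbb{C}^{n\times m}$ is its evaluation at $\lambda\in\mathbb{C}$. The space $\mathfrak{R}$ is identified with $\mathbb{R}^G$, $G=\sum_{i,j}n_{i,j}m_{i,j}(g_{i,j}+1)$, by listing all matrix entries. A set $\mathbb{V}\subseteq\mathbb{R}^G$ is an algebraic variety if it is the set of common zeros of finitely many polynomials in $\mathbb{R}[x_1,\dots,x_G]$; it is proper if $\mathbb{V}\neq\mathbb{R}^G$. A set $S\subseteq\mathbb{R}^G$ is generic if its complement is contained in some proper algebraic variety. *)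

(* Defs.v *)
From mathcomp Require Import all_boot all_order all_algebra.
From mathcomp Require Import classical_sets reals.
From mathcomp Require Import complex.
From mathcomp Require Import mpoly.

Set Implicit Arguments.
Unset Strict Implicit.
Unset Printing Implicit Defensive.

Import Order.TTheory GRing.Theory Num.Theory.

Local Open Scope classical_set_scope.
Local Open Scope ring_scope.

Section AlgebraicVarieties.
Variables (R : realType) (N : nat).

Definition algebraic_variety (V : set 'rV[R]_N) : Prop :=
  exists s : seq {mpoly R[N]},
    V = [set v : 'rV[R]_N | forall f, f \in s -> f.@[fun k => v 0 k] = 0].

Definition generic (S : set 'rV[R]_N) : Prop :=
  exists V : set 'rV[R]_N,
    [/\ algebraic_variety V, V <> setT & ~` S `<=` V].

End AlgebraicVarieties.

Section BlockPolynomialMatrices.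
Variables (R : realType) (p q : nat).
Variables (n_ m_ g : 'I_p -> 'I_q -> nat).

(* [P i j k] is the coefficient of ['X^k] in the block [(i, j)]. *)
Definition coef_space : Type :=
  forall (i : 'I_p) (j : 'I_q), 'I_(g i j).+1 -> 'M[R]_(n_ i j, m_ i j).

(* A tuple [((i, j); (k, (a, b)))] points at the entry [(a, b)] of [P i j k]. *)
Definition entry_index : finType :=
  {ij : 'I_p * 'I_q &
    ('I_(g ij.1 ij.2).+1 * ('I_(n_ ij.1 ij.2) * 'I_(m_ ij.1 ij.2)))%type}.

Definition coef_dim : nat := #|entry_index|.

Lemma coef_dimE :
  coef_dim = (\sum_(i < p) \sum_(j < q) n_ i j * m_ i j * (g i j).+1)%N.
Proof.
rewrite /coef_dim card_tagged sumnE big_map big_enum /=.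
rewrite pair_big /=; apply: eq_bigr => -[i j] _ /=.
by rewrite !card_prod !card_ord mulnC.
Qed.

Definition entry (P : coef_space) (e : entry_index) : R :=
  P (tag e).1 (tag e).2 (tagged e).1 (tagged e).2.1 (tagged e).2.2.

(* The identification of the coefficient space with R^G, the entries being
   listed in the order of [enum entry_index]. *)
Definition coords (P : coef_space) : 'rV[R]_coef_dim :=
  \row_(k < coef_dim) entry P (enum_val k).

Definition of_coords (v : 'rV[R]_coef_dim) : coef_space :=
  fun i j k => \matrix_(a, b)
    v 0 (enum_rank (existT _ (i, j) (k, (a, b)) : entry_index)).

Lemma coordsK (P : coef_space) (i : 'I_p) (j : 'I_q) (k : 'I_(g i j).+1) :
  @of_coords (coords P) i j k = P i j k.
Proof. by apply/matrixP => a b; rewrite !mxE enum_rankK. Qed.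

Lemma of_coordsK : cancel of_coords coords.
Proof.
move=> v; apply/rowP => k; rewrite !mxE /entry !mxE.
rewrite -[in RHS](enum_valK k); congr (v 0 (enum_rank _)).
by case: (enum_val k) => -[i j] [l [a b]].
Qed.

Definition block_poly (P : coef_space) (i : 'I_p) (j : 'I_q) :
    'M[{poly R}]_(n_ i j, m_ i j) :=
  \sum_(k < (g i j).+1) 'X^k *: map_mx polyC (P i j k).

(* The height of the block row [i] and the width of the block column [j] are
   read off at the reference column [j0] and the reference row [i0]; the casts
   transport blocks along the compatibility equations, entries unchanged. *)
Definition hat_poly (n m : nat)
    (hn : forall i j k, n_ i j = n_ i k)
    (hns : forall k, (\sum_(i < p) n_ i k)%N = n)
    (hm : forall i j k, m_ i k = m_ j k)
    (hms : forall j, (\sum_(k < q) m_ j k)%N = m)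
    (i0 : 'I_p) (j0 : 'I_q) (P : coef_space) : 'M[{poly R}]_(n, m) :=
  castmx (hns j0, hms i0)
    (\mxblock_(i < p, j < q) castmx (hn i j j0, hm i i0 j) (block_poly P i j)).

End BlockPolynomialMatrices.

Definition eval_mx (R : realType) (n m : nat) (A : 'M[{poly R}]_(n, m))
    (z : R[i]) : 'M[R[i]]_(n, m) :=
  map_mx (fun f : {poly R} => (map_poly (real_complex R) f).[z]) A.

(* Main.v *)
Require Import Defs.
From mathcomp Require Import all_boot all_order all_algebra all_fingroup.
From mathcomp Require Import classical_sets reals.
From mathcomp Require Import complex polyrcf mpoly lra.

(** If [d < m] (the case [d < n] is symmetric), the two [d]-minors on the first
    [d] rows, one omitting the last and one omitting the first of [d + 1]
    suitably ordered columns, generically have no common root: their Sylvester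
    determinant, taken at fixed formal degrees so that it is a polynomial in the
    coefficients, equals [1] at a bidiagonal matrix.  If all degrees are [0], a
    single minor suffices.

    Conversely, if [d = n = m] and some [g i j > 0], the determinant of some
    [P0] is [+- ('X - 2)].  On the segment from [P0] to a point outside a given
    proper variety, the determinant still changes sign between [1] and [3] for
    all small parameters, and only finitely many of these lie on the variety. *)

Set Implicit Arguments.
Unset Strict Implicit.
Unset Printing Implicit Defensive.

Import Order.TTheory GRing.Theory Num.Theory.

Local Open Scope classical_set_scope.
Local Open Scope ring_scope.

(** * Sylvester matrices and common roots *)

(* Formal degrees, unlike those of [Sylvester_mx], survive specialization. *)
Definition sylv (A : comNzRingType) (N1 N2 : nat) (f g : {poly A}) :
    'M[A]_(N1 + N2) :=
  col_mx (\matrix_(i < N1, k < N1 + N2) (g * 'X^i)`_k)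
         (\matrix_(i < N2, k < N1 + N2) (f * 'X^i)`_k).

Lemma map_sylv (A B : comNzRingType) (phi : {rmorphism A -> B}) N1 N2 f g :
  map_mx phi (sylv N1 N2 f g) = sylv N1 N2 (map_poly phi f) (map_poly phi g).
Proof.
rewrite /sylv map_col_mx; congr col_mx; apply/matrixP=> i k.
  by rewrite !mxE -(map_polyXn phi) -rmorphM coef_map.
by rewrite !mxE -(map_polyXn phi) -rmorphM coef_map.
Qed.

(** With the multiples of [g = 1] listed first, the rows are the monomials of degree 0, 1, 2, ... in
    order. *)
Lemma sylv_Xn_1 (A : comNzRingType) N1 N2 :
  sylv N1 N2 'X^N1 1 = 1%:M :> 'M[A]__.
Proof.
apply/matrixP=> i k; rewrite mxE; case: splitP => j ij.
  by rewrite !mxE mul1r coefXn -val_eqE /= ij eq_sym.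
by rewrite !mxE -exprD coefXn -val_eqE /= ij eq_sym.
Qed.

(** A common root [z] puts the vector of powers of [z] in the kernel, and the entry of index 0 of
    that vector is 1. *)
Lemma det_sylv_root (K : fieldType) N1 N2 (f g : {poly K}) z :
  (0 < N1 + N2)%N -> (size f <= N1.+1)%N -> (size g <= N2.+1)%N ->
  root f z -> root g z -> \det (sylv N1 N2 f g) = 0.
Proof.
move=> N_gt0 sf sg /rootP fz /rootP gz.
pose u : 'cV[K]_(N1 + N2) := \col_k z ^+ k.
have su : sylv N1 N2 f g *m u = 0.
  (* Each row pairs with [u] to the value of [h * 'X^i] at [z]; the size bound ensures that no
     coefficient is cut off. *)
  have hz (h : {poly K}) i N N' : (size h <= N'.+1)%N -> (i < N)%N ->
      (N + N' = N1 + N2)%N -> h.[z] = 0 ->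
      \sum_(k < N1 + N2) (h * 'X^i)`_k * u k 0 = 0.
    move=> sh iN eN hz0; under eq_bigr => k _ do rewrite mxE.
    rewrite -horner_coef_wide ?hornerM ?hz0 ?mul0r // -eN.
    apply: leq_trans (size_polyMleq _ _) _; rewrite size_polyXn addnS /=.
    rewrite (leq_trans (leq_add sh (leqnn i))) // addSnnS addnC.
    by rewrite leq_add2r.
  apply/colP=> i; rewrite !mxE; case: (splitP i) => j ij.
    rewrite -[RHS](hz g j N1 N2 sg (ltn_ord j) erefl gz).
    apply: eq_bigr => k _; rewrite [sylv _ _ _ _ _ _]mxE; case: splitP => l.
      by rewrite ij mxE => /val_inj <-.
    by rewrite ij => e; move: (ltn_ord j); rewrite e ltnNge leq_addr.
  rewrite -[RHS](hz f j N2 N1 sf (ltn_ord j) (addnC _ _) fz).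
  apply: eq_bigr => k _; rewrite [sylv _ _ _ _ _ _]mxE; case: splitP => l.
    by rewrite ij => e; move: (ltn_ord l); rewrite -e ltnNge leq_addr.
  by rewrite ij mxE => /addnI/val_inj <-.
apply/eqP; apply: contraTT isT => nz.
have inv : sylv N1 N2 f g \in unitmx by rewrite unitmxE unitfE.
have := mulKmx inv u; rewrite su mulmx0 => /matrixP /(_ (Ordinal N_gt0) 0).
by rewrite !mxE expr0 => /eqP; rewrite eq_sym oner_eq0.
Qed.

(** * Degrees of determinants, and ranks from minors *)

Lemma size_det_leq (A : comNzRingType) d (M : 'M[{poly A}]_d)
    (G : 'I_d -> 'I_d -> nat) N :
  (forall i j, size (M i j) <= (G i j).+1)%N ->
  (forall s : {perm 'I_d}, \sum_i G i (s i) <= N)%N ->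
  (size (\det M) <= N.+1)%N.
Proof.
move=> sM sN; apply: leq_trans (size_sum _ _ _) _.
apply/bigmax_leqP => s _; rewrite mulr_sign.
rewrite (fun_if (fun x : {poly A} => size x)) size_polyN if_same.
apply: leq_trans (size_poly_prod_leq _ _) _.
rewrite leq_subLR; apply: leq_trans (_ : ((\sum_i (G i (s i)).+1).+1 <= _)%N).
  by rewrite ltnS; apply: leq_sum.
under eq_bigr do rewrite -addn1.
by rewrite big_split /= sum1_card addnC addnS ltnS leq_add2l.
Qed.

Lemma rank_mxsub_leq (K : fieldType) n m n' m' (r : 'I_n' -> 'I_n)
    (c : 'I_m' -> 'I_m) (A : 'M[K]_(n, m)) :
  (\rank (mxsub r c A) <= \rank A)%N.
Proof.
have rowsub_leq k l k' (s : 'I_k' -> 'I_k) (B : 'M[K]_(k, l)) :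
    (\rank (rowsub s B) <= \rank B)%N.
  apply/mxrankS/row_subP => i; rewrite row_rowsub; exact: row_sub.
have -> : mxsub r c A = (rowsub c (rowsub r A)^T)^T.
  by apply/matrixP=> i j; rewrite !mxE.
rewrite mxrank_tr; apply: leq_trans (rowsub_leq _ _ _ _ _) _.
by rewrite mxrank_tr rowsub_leq.
Qed.

Lemma rank_geq_minor (K : fieldType) n m d (r : 'I_d -> 'I_n)
    (c : 'I_d -> 'I_m) (A : 'M[K]_(n, m)) :
  \det (mxsub r c A) != 0 -> (d <= \rank A)%N.
Proof.
move=> nz; rewrite -[d in (d <= _)%N](@mxrank_unit K d (mxsub r c A)).
  exact: rank_mxsub_leq.
by rewrite unitmxE unitfE.
Qed.

(** * Matrices of polynomials with coefficients read from coordinates *)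

(** The ring [A] varies: [R] for one matrix, [{mpoly R[N]}] for the universal matrix, [{poly R}] for
    a line of matrices. *)
Definition coef_mx (A : nzRingType) n m N (G : 'I_n -> 'I_m -> nat)
    (idx : 'I_n -> 'I_m -> nat -> 'I_N) (v : 'I_N -> A) : 'M[{poly A}]_(n, m) :=
  \matrix_(a, b) \poly_(k < (G a b).+1) v (idx a b k).

Lemma map_coef_mx (A B : nzRingType) (phi : {rmorphism A -> B}) n m N G idx v :
  map_mx (map_poly phi) (@coef_mx A n m N G idx v)
    = coef_mx G idx (fun k => phi (v k)).
Proof.
apply/matrixP=> a b; rewrite !mxE; apply/polyP=> k.
by rewrite coef_map !coef_poly; case: ifP => _ //; exact: rmorph0.
Qed.

Lemma tr_coef_mx (A : nzRingType) n m N G idx v :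
  (@coef_mx A n m N G idx v)^T
    = coef_mx (fun b a => G a b) (fun b a => idx a b) v.
Proof. by apply/matrixP=> a b; rewrite !mxE. Qed.

Definition ceval (R : realType) (z : R[i]) : {rmorphism {poly R} -> R[i]} :=
  horner_eval z \o map_poly (real_complex R).

Lemma eval_mxE (R : realType) n m (M : 'M[{poly R}]_(n, m)) z :
  eval_mx M z = map_mx (ceval z) M.
Proof. by []. Qed.

(** * Generic rank when [d < m] *)

Section CommonRoots.
Variables (R : realType) (n m N : nat).
Variables (G : 'I_n -> 'I_m -> nat) (idx : 'I_n -> 'I_m -> nat -> 'I_N).

(** Distinct coefficients occupy distinct coordinates, phrased as an interpolation property. *)
Definition free_coords := forall phi : 'I_n -> 'I_m -> nat -> R,
  exists v : 'I_N -> R,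
    forall a b k, (k <= G a b)%N -> v (idx a b k) = phi a b k.

Lemma coef_mx_surj (B : 'M[{poly R}]_(n, m)) : free_coords ->
  (forall a b, (size (B a b) <= (G a b).+1)%N) -> exists v, coef_mx G idx v = B.
Proof.
move=> free sB; have [v vB] := free (fun a b k => (B a b)`_k); exists v.
apply/matrixP=> a b; rewrite mxE; apply/polyP=> k; rewrite coef_poly ltnS.
case: leqP => [/vB //|lt_k]; apply/esym/nth_default.
exact: leq_trans (sB a b) _.
Qed.

Local Notation generic_mx := (coef_mx G idx (fun k => 'X_k : {mpoly R[N]})).

Lemma meval_generic_mx v :
  map_mx (map_poly (meval v)) generic_mx = coef_mx G idx v.
Proof.
rewrite (map_coef_mx (meval v)); congr coef_mx.
by apply/boolp.funext=> k; exact: mevalXU.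
Qed.

Definition generic_minor d (r : 'I_d -> 'I_n) (c : 'I_d -> 'I_m) :=
  \det (mxsub r c generic_mx).

Lemma meval_generic_minor d (r : 'I_d -> 'I_n) (c : 'I_d -> 'I_m) v :
  map_poly (meval v) (generic_minor r c) = \det (mxsub r c (coef_mx G idx v)).
Proof. by rewrite -det_map_mx map_mxsub meval_generic_mx. Qed.

(** Applied to two minors at once: a rank below [d] makes [z] a common root of both. *)
Lemma minor_root d (r : 'I_d -> 'I_n) (c : 'I_d -> 'I_m) v z :
  (d <= \rank (eval_mx (coef_mx G idx v) z))%N
  \/ root (map_poly (real_complex R)
             (map_poly (meval v) (generic_minor r c))) z.
Proof.
have [nz|z0] := boolP (\det (mxsub r c (eval_mx (coef_mx G idx v) z)) != 0).
  by left; apply: rank_geq_minor nz.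
right; rewrite meval_generic_minor; apply/rootP.
by move/eqP: (negbNE z0); rewrite eval_mxE -map_mxsub det_map_mx.
Qed.

Hypothesis free : free_coords.

(* The first [d] of the [d + 1] columns are ordered so that the diagonal degrees
   add up to the formal degree [N1] of the minor they form.  Hence a matrix with
   entries ['X^(G _ _)] on the diagonal and [1] above it has the minors ['X^N1]
   and [1], of Sylvester determinant [1]. *)
Lemma rank_generic_wide d : (d <= n)%N -> (d < m)%N ->
  exists2 h : {mpoly R[N]}, exists v, h.@[v] != 0 &
    forall v z, h.@[v] != 0 -> (d <= \rank (eval_mx (coef_mx G idx v) z))%N.
Proof.
move=> le_dn lt_dm.
pose r := widen_ord le_dn; pose c0 := @widen_ord d.+1 m lt_dm.
pose wt (s : {perm 'I_d}) := (\sum_i G (r i) (c0 (lift ord_max (s i))))%N.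
have [s wt_max] : exists s, forall t, (wt t <= wt s)%N.
  by exists [arg max_(s > 1%g) wt s]%N => t; case: arg_maxnP => // s _; apply.
(* The permutation [s] is extended to fix the last column, so only the first [d] columns are
   reordered. *)
pose c j := c0 (lift_perm ord_max ord_max s j).
have r_inj : injective r.
  by move=> i j e; apply/ord_inj/(congr1 (@nat_of_ord n) e).
have c_inj : injective c.
  move=> i j e; apply: (@perm_inj _ (lift_perm ord_max ord_max s)).
  exact/ord_inj/(congr1 (@nat_of_ord m) e).
pose c1 (i : 'I_d) := c (lift ord_max i); pose c2 (i : 'I_d) := c (lift ord0 i).
(* [N1] must be the exact degree at the witness below, while [N2] may be any upper bound; the
   successor makes [N1 + N2] visibly positive. *)
pose F1 := generic_minor r c1; pose F2 := generic_minor r c2.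
pose N1 := wt s; pose N2 := (size F2).+1.
have sF1 v : (size (map_poly (meval v) F1) <= N1.+1)%N.
  rewrite meval_generic_minor.
  apply: (@size_det_leq _ _ _ (fun i j => G (r i) (c1 j))) => [i j|t].
    by rewrite !mxE size_poly.
  (* Permuting the columns [c1] by [t] gives the weight of [t * s], which the maximality of [s]
     bounds. *)
  apply: leq_trans (wt_max (t * s)%g); apply: leq_sum => i _.
  by rewrite /c1 /c lift_perm_lift permM.
have sF2 v : (size (map_poly (meval v) F2) <= N2.+1)%N.
  by apply: leq_trans (size_poly _ _) _; apply: leqW; apply: leqnSn.
exists (\det (sylv N1 N2 F1 F2)); last first.
  move=> v z; rewrite -det_map_mx map_sylv => nz.
  have [//|z1] := minor_root r c1 v z; have [//|z2] := minor_root r c2 v z.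
  case/eqP: nz; apply: (fmorph_inj (real_complex R)).
  rewrite -det_map_mx map_sylv rmorph0; apply: det_sylv_root z1 z2.
  - by rewrite addnS.
  - by rewrite size_map_poly.
  - by rewrite size_map_poly.
have [B sB Bc] : exists2 B : 'M[{poly R}]_(n, m),
    forall a b, (size (B a b) <= (G a b).+1)%N &
    forall i j, B (r i) (c j) = if lift ord_max i == j
      then 'X^(G (r i) (c j)) else (lift ord0 i == j)%:R.
  (* The existentials invert the injections [r], [c1] and [c2]; entries off the two diagonals, in
     particular outside the chosen rows and columns, are 0. *)
  exists (\matrix_(a, b) if [exists i, (r i == a) && (c1 i == b)]
    then 'X^(G a b) else [exists i, (r i == a) && (c2 i == b)]%:R).
    move=> a b; rewrite mxE; case: ifP => _; first by rewrite size_polyXn.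
    by case: [exists _, _]; rewrite ?size_poly1 ?size_poly0.
  have ex (i : 'I_d) (l : 'I_d -> 'I_d.+1) j :
      [exists i', (r i' == r i) && (c (l i') == c j)] = (l i == j).
    apply/existsP/eqP => [[i' /andP[/eqP/r_inj -> /eqP/c_inj //]]|<-].
    by exists i; rewrite !eqxx.
  by move=> i j; rewrite mxE !ex.
have [v vB] := coef_mx_surj free sB.
have lift_eq (i j : 'I_d) :
    (lift ord0 i == lift ord_max j) = (j == i.+1 :> nat).
  by rewrite -val_eqE /= /bump /= leqNgt ltn_ord add0n eq_sym.
(* Dropping the last column leaves an upper triangular matrix, whence the transpose; dropping the
   first leaves a lower triangular one with 1 on the diagonal. *)
have f1 : \det (mxsub r c1 B) = 'X^N1.
  rewrite -det_tr det_trig.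
    under eq_bigr => i _ do rewrite 2!mxE Bc eqxx /c lift_perm_lift.
    by rewrite prodrXr -/(wt s).
  apply/is_trig_mxP => i j lt_ij; rewrite 2!mxE Bc (inj_eq lift_inj).
  by rewrite lift_eq -val_eqE (gtn_eqF lt_ij) (ltn_eqF (leqW lt_ij)).
have f2 : \det (mxsub r c2 B) = 1.
  rewrite det_trig.
    apply: big1 => i _; rewrite mxE Bc eqxx eq_sym lift_eq.
    by rewrite ltn_eqF.
  apply/is_trig_mxP => i j lt_ij; rewrite mxE Bc (inj_eq lift_inj).
  rewrite eq_sym lift_eq -[i == j]val_eqE (ltn_eqF lt_ij).
  by rewrite (ltn_eqF (leqW lt_ij)).
have sylv1 : sylv N1 N2 (\det (mxsub r c1 B)) (\det (mxsub r c2 B)) = 1%:M.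
  by rewrite f1 f2 sylv_Xn_1.
exists v; rewrite -det_map_mx map_sylv !meval_generic_minor vB sylv1 det1.
exact: oner_neq0.
Qed.

End CommonRoots.

(** * Generic rank when [d < n], and for constant matrices *)

Section GenericRank.
Variables (R : realType) (n m N : nat).
Variables (G : 'I_n -> 'I_m -> nat) (idx : 'I_n -> 'I_m -> nat -> 'I_N).
Hypothesis free : free_coords R G idx.

Lemma rank_generic_tall d : (d < n)%N -> (d <= m)%N ->
  exists2 h : {mpoly R[N]}, exists v, h.@[v] != 0 &
    forall v z, h.@[v] != 0 -> (d <= \rank (eval_mx (coef_mx G idx v) z))%N.
Proof.
move=> lt_dn le_dm.
have freeT : free_coords R (fun b a => G a b) (fun b a => idx a b).
  move=> phi; have [v vP] := free (fun a b => phi b a).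
  by exists v => b a; apply: vP.
have [h h0 hP] := rank_generic_wide freeT le_dm lt_dn.
exists h => // v z /hP-/(_ z); rewrite -tr_coef_mx.
by rewrite !eval_mxE -matrix.map_trmx mxrank_tr.
Qed.

Lemma rank_generic_const d : (d <= n)%N -> (d <= m)%N ->
  (forall a b, G a b = 0%N) ->
  exists2 h : {mpoly R[N]}, exists v, h.@[v] != 0 &
    forall v z, h.@[v] != 0 -> (d <= \rank (eval_mx (coef_mx G idx v) z))%N.
Proof.
move=> le_dn le_dm G0; pose r := widen_ord le_dn; pose c := widen_ord le_dm.
pose C (A : nzRingType) (v : 'I_N -> A) := \matrix_(a, b) v (idx a b 0%N).
have CE v : coef_mx G idx v = map_mx polyC (C R v).
  by apply/matrixP=> a b; rewrite !mxE G0 poly_def big_ord1 alg_polyC.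
pose h := \det (mxsub r c (C {mpoly R[N]} (fun k => 'X_k))).
have hE v : h.@[v] = \det (mxsub r c (C R v)).
  rewrite -det_map_mx; congr (\det _); apply/matrixP=> a b; rewrite !mxE.
  exact: mevalXU.
exists h.
  have [v vE] := free (fun a b _ => (a == b :> nat)%:R).
  exists v; rewrite hE.
  suff -> : mxsub r c (C R v) = 1%:M by rewrite det1 oner_neq0.
  by apply/matrixP=> i j; rewrite !mxE vE.
move=> v z; rewrite hE => nz; apply: (@rank_geq_minor _ _ _ _ r c).
have -> : eval_mx (coef_mx G idx v) z = map_mx (real_complex R) (C R v).
  by apply/matrixP=> a b; rewrite CE !mxE map_polyC hornerC.
by rewrite -map_mxsub det_map_mx fmorph_eq0.
Qed.

End GenericRank.

(** * Rank defects outside any proper variety *)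

Section RankDefect.
Variable R : realType.

(** By continuity [p] stays negative on some [[0, e)], which contains more points than [f] has
    roots. *)
Lemma horner_neg_neq0 (p f : {poly R}) : p.[0] < 0 -> f != 0 ->
  exists2 t, p.[t] < 0 & f.[t] != 0.
Proof.
rewrite -oppr_gt0 => p0 f0; have [e e0 pe] := poly_cont 0 p p0.
have ptN t : 0 <= t < e -> p.[t] < 0.
  case/andP=> t0 te; have := pe t; rewrite subr0 ger0_norm // => /(_ te).
  by rewrite ltr_norml => /andP[_]; rewrite ltrBlDr addNr.
(* These are [size f] distinct points; the denominators start at 2 to keep them strictly below
   [e]. *)
pose ts := [seq e / k.+2%:R | k <- iota 0 (size f)].
have [all_root|] := boolP (all (root f) ts).
  have uniq_ts : uniq ts.
    rewrite map_inj_uniq ?iota_uniq // => k l /(mulfI (lt0r_neq0 e0)) /invr_inj.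
    by move/eqP; rewrite eqr_nat => /eqP [].
  have := max_poly_roots f0 all_root uniq_ts.
  by rewrite size_map size_iota ltnn.
case/allPn => _ /mapP[k _ ->] fk; exists (e / k.+2%:R) => //; apply: ptN.
rewrite divr_ge0 ?ler0n ?(ltW e0) //= ltr_pdivrMr ?ltr0n //.
by rewrite -[X in X < _]mulr1 ltr_pM2l // ltr1n.
Qed.

Lemma meval_line N (f : {mpoly R[N]}) (u w : 'I_N -> R) t :
  (mmap polyC (fun k => (u k)%:P + (w k)%:P * 'X) f).[t]
    = f.@[fun k => u k + w k * t].
Proof.
rewrite /mmap mevalE horner_sum; apply: eq_bigr => mn _.
rewrite hornerM hornerC horner_prod; congr (_ * _); apply: eq_bigr => k _.
by rewrite horner_exp !hornerE.
Qed.

(** Of the two nested variables, the outer one is that of the matrix entries, set to the constant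
    [x], and the inner one is the parameter [t] of the line. *)
Lemma det_coef_mx_line n N (G : 'I_n -> 'I_n -> nat) idx (u w : 'I_N -> R) x t :
  (\det (coef_mx G idx (fun k => (u k)%:P + (w k)%:P * 'X))).[x%:P].[t]
    = (\det (coef_mx G idx (fun k => u k + w k * t))).[x].
Proof.
have <- : map_mx (map_poly (horner_eval t))
    (coef_mx G idx (fun k => (u k)%:P + (w k)%:P * 'X))
  = coef_mx G idx (fun k => u k + w k * t).
  rewrite (map_coef_mx (horner_eval t)); congr coef_mx.
  by apply/boolp.funext => k; rewrite /= /horner_eval !hornerE.
rewrite det_map_mx -[x in RHS](hornerC x t).
by rewrite -/(horner_eval t x%:P) horner_map.
Qed.

Lemma rank_lt_of_root n (M : 'M[{poly R}]_n) (x : R) :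
  root (\det M) x -> (\rank (eval_mx M (real_complex R x)) < n)%N.
Proof.
move=> /rootP Mx; rewrite ltn_neqAle rank_leq_row andbT.
rewrite -/(row_free _) row_free_unit unitmxE unitfE negbK eval_mxE det_map_mx.
by rewrite /= /horner_eval horner_map Mx rmorph0.
Qed.

Lemma rank_defect_dense n N (G : 'I_n -> 'I_n -> nat) idx a0 b0
    (f : {mpoly R[N]}) v0 :
  free_coords R G idx -> (0 < G a0 b0)%N -> f.@[v0] != 0 ->
  exists v x, [/\ f.@[v] != 0, 0 <= x &
    (\rank (eval_mx (coef_mx G idx v) (real_complex R x)) < n)%N].
Proof.
move=> free G0 fv0; pose s := tperm a0 b0.
pose e : 'rV[{poly R}]_n := \row_a if a == a0 then 'X - 2%:P else 1.
(* The permutation matrix moves the entry ['X - 2] of row [a0] to column [b0], where degree 1 is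
   allowed. *)
have [|u uB] := coef_mx_surj (B := diag_mx e *m perm_mx s) free.
  move=> a b; rewrite mul_diag_mx !mxE; have [->|_] := eqVneq a a0; last first.
    by rewrite mul1r; case: (_ == _); rewrite ?size_poly1 ?size_poly0.
  rewrite tpermL; have [<-|_] := eqVneq b0 b; last by rewrite mulr0 size_poly0.
  by rewrite mulr1 size_XsubC.
have detB x : (\det (coef_mx G idx u)).[x] = (x - 2) * (-1) ^+ s.
  rewrite uB det_mulmx det_diag det_perm hornerM; congr (_ * _).
    rewrite horner_prod (bigD1 a0) //= big1 => [|a /negbTE ne].
      by rewrite mxE eqxx mulr1 hornerXsubC.
    by rewrite mxE ne hornerC.
  by case: (s : bool); rewrite ?expr1 ?expr0 ?hornerN hornerC.
pose line k : {poly R} := (u k)%:P + (v0 k - u k)%:P * 'X.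
pose D := \det (coef_mx G idx line).
have line0 : (fun k => u k + (v0 k - u k) * 0) = u.
  by apply/boolp.funext => k; rewrite mulr0 addr0.
have line1 : (fun k => u k + (v0 k - u k) * 1) = v0.
  by apply/boolp.funext => k; rewrite mulr1 addrC subrK.
(* A negative product of the values at 1 and 3 encodes the sign change as one polynomial condition
   on [t]; at [t = 0] the product is -1, the sign of [s] being squared away. *)
have [||t pt ft] := @horner_neg_neq0 (D.[1%:P] * D.[3%:P]) (mmap polyC line f).
- rewrite hornerM !det_coef_mx_line line0 !detB mulrACA -expr2 sqrr_sign mulr1.
  by lra.
(* The restriction of [f] to the line is nonzero, since at [t = 1] it takes the value of [f] at
   [v0]. *)
- apply/eqP => f0; case/eqP: fv0.
  by rewrite -line1 -meval_line -/line f0 horner0.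
move: pt; rewrite hornerM !det_coef_mx_line => pt.
have [|x] := poly_ivtoo _ pt; first by lra.
rewrite in_itv /= => /andP[x1 _] rx.
exists (fun k => u k + (v0 k - u k) * t), x; split.
- by rewrite -meval_line.
- exact: le_trans ler01 (ltW x1).
- exact: rank_lt_of_root.
Qed.

End RankDefect.

(** * The block matrix as an instance of [coef_mx] *)

Section HatPoly.
Variables (R : realType) (n m p q : nat).
Variables (n_ m_ g : 'I_p -> 'I_q -> nat).
Hypotheses (hn : forall i j k, n_ i j = n_ i k)
  (hns : forall k, (\sum_(a < p) n_ a k)%N = n)
  (hm : forall i j k, m_ i k = m_ j k)
  (hms : forall j, (\sum_(b < q) m_ j b)%N = m).
Variables (i0 : 'I_p) (j0 : 'I_q).

Let row_sig (a : 'I_n) := cast_ord (esym (hns j0)) a.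
Let col_sig (b : 'I_m) := cast_ord (esym (hms i0)) b.
Let brow (a : 'I_n) : 'I_p := tagnat.sig1 (row_sig a).
Let bcol (b : 'I_m) : 'I_q := tagnat.sig1 (col_sig b).

Definition hat_degree (a : 'I_n) (b : 'I_m) := g (brow a) (bcol b).

(** The default value of [inord] is harmless: [coef_mx] only reads [k] up to the degree bound of the
    block. *)
Definition hat_index (a : 'I_n) (b : 'I_m) (k : nat) : 'I_(coef_dim n_ m_ g) :=
  enum_rank (existT _ (brow a, bcol b)
    (inord k, (cast_ord (hn (brow a) j0 (bcol b)) (tagnat.sig2 (row_sig a)),
               cast_ord (hm i0 (brow a) (bcol b)) (tagnat.sig2 (col_sig b))))
    : entry_index n_ m_ g).

Lemma hat_polyE (P : coef_space R n_ m_ g) :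
  hat_poly hn hns hm hms i0 j0 P
    = coef_mx hat_degree hat_index (fun k => coords P 0 k).
Proof.
apply/matrixP=> a b; rewrite !castmxE !mxE castmxE summxE poly_def.
apply: eq_bigr => k _; rewrite !mxE enum_rankK /entry /= inord_val.
rewrite mulrC mul_polyC.
by congr (P _ _ _ _ _ *: _); apply: val_inj.
Qed.

Lemma hat_free_coords : free_coords R hat_degree hat_index.
Proof.
move=> phi.
(* [row_of] and [col_of] send a position inside a block to its position in the whole matrix, undoing
   [tagnat.sig1] and [tagnat.sig2]. *)
pose row_of i j (x : 'I_(n_ i j)) : 'I_n :=
  cast_ord (hns j0) (@tagnat.Rank p (n_^~ j0) i (cast_ord (hn i j j0) x)).
pose col_of i j (y : 'I_(m_ i j)) : 'I_m :=
  cast_ord (hms i0) (@tagnat.Rank q (m_ i0) j (cast_ord (hm i i0 j) y)).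
pose P : coef_space R n_ m_ g :=
  fun i j k => \matrix_(x, y) phi (row_of i j x) (col_of i j y) k.
exists (fun k => coords P 0 k) => a b k le_k.
rewrite mxE enum_rankK /entry /= mxE inordK //; congr (phi _ _ _).
  apply: (@cast_ord_inj _ _ (esym (hns j0))); rewrite cast_ordK.
  rewrite -[RHS]tagnat.sig2K; congr tagnat.Rank; exact: val_inj.
apply: (@cast_ord_inj _ _ (esym (hms i0))); rewrite cast_ordK.
rewrite -[RHS]tagnat.sig2K; congr tagnat.Rank; exact: val_inj.
Qed.

(** Blocks are nonempty, so each [g i j] is the degree bound of some entry. *)
Lemma hat_degree_eq0 :
  (forall i j, 0 < n_ i j)%N -> (forall i j, 0 < m_ i j)%N ->
  (forall a b, hat_degree a b = 0%N) <-> (forall i j, g i j = 0%N).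
Proof.
move=> n_gt0 m_gt0; split=> [h i j|h a b]; last exact: h.
pose a := @tagnat.Rank p (n_^~ j0) i (Ordinal (n_gt0 i j0)).
pose b := @tagnat.Rank q (m_ i0) j (Ordinal (m_gt0 i0 j)).
have := h (cast_ord (hns j0) a) (cast_ord (hms i0) b).
by rewrite /hat_degree /brow /bcol /row_sig /col_sig !cast_ordK !tagnat.Rank1K.
Qed.

End HatPoly.

(** * Genericity through a single polynomial, and the equivalence *)

(** A proper variety lies in the zero set of one of its equations that is not identically zero, and
    such a zero set is itself a proper variety. *)
Lemma genericP (R : realType) N (S : set 'rV[R]_N) :
  generic S <-> exists2 h : {mpoly R[N]}, exists v, h.@[v] != 0 &
    forall v, h.@[v] != 0 -> S (\row_k v k).
Proof.
split=> [[V [[s Vs] VT SV]]|[h [v0 hv0] hS]].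
  have [v [f fs fv]] : exists v : 'rV[R]_N, exists2 f, f \in s & f.@[v 0] != 0.
    apply: boolp.contrapT => nS; apply: VT; rewrite -subTset Vs => v _ f fs.
    apply/eqP; apply: boolp.contrapT => fv; apply: nS.
    by exists v, f => //; apply/negP.
  exists f; first by exists (v 0).
  move=> u fu; apply: boolp.contrapT => /SV; rewrite Vs => /(_ f fs) /eqP.
  have -> : (fun k => (\row_k u k) 0 k) = u.
    by apply/boolp.funext => k; rewrite mxE.
  by rewrite (negbTE fu).
exists [set v | h.@[v 0] = 0]; split.
- exists [:: h]; apply/seteqP; split => v /= hv.
    by move=> f; rewrite inE => /eqP ->.
  by apply: hv; rewrite inE.
- move=> VT; case/eqP: hv0.
  have : [set v : 'rV[R]_N | h.@[v 0] = 0] (\row_k v0 k) by rewrite VT.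
  rewrite /=; suff -> : (\row_k v0 k : 'rV_N) 0 = v0 by [].
  by apply/boolp.funext => k; rewrite mxE.
- move=> v /= nS; apply/eqP; apply: boolp.contrapT => /negP /hS.
  suff -> : \row_k v 0 k = v by [].
  by apply/rowP => k; rewrite mxE.
Qed.

Theorem proposition3p16 (R : realType) (n m p q d : nat)
    (n_gt0 : (0 < n)%N) (m_gt0 : (0 < m)%N)
    (p_gt0 : (0 < p)%N) (q_gt0 : (0 < q)%N)
    (n_ m_ g : 'I_p -> 'I_q -> nat)
    (n__gt0 : forall i j, (0 < n_ i j)%N)
    (m__gt0 : forall i j, (0 < m_ i j)%N)
    (hn : forall i j k, n_ i j = n_ i k)
    (hns : forall k, (\sum_(a < p) n_ a k)%N = n)
    (hm : forall i j k, m_ i k = m_ j k)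
    (hms : forall j, (\sum_(b < q) m_ j b)%N = m) :
  generic (@coords R p q n_ m_ g @`
    [set P | forall z : R[i], 0 <= complex.Re z ->
       (d <= \rank (eval_mx (hat_poly hn hns hm hms
                     (Ordinal p_gt0) (Ordinal q_gt0) P) z))%N])
  <->
  (d <= minn n m)%N /\
  (~ (d = n /\ n = m) \/ forall i j, g i j = 0%N).
Proof.
set S := (X in generic X).
pose G := @hat_degree n m p q n_ m_ g hns hms (Ordinal p_gt0) (Ordinal q_gt0).
pose idx := @hat_index n m p q n_ m_ g hn hns hm hms
  (Ordinal p_gt0) (Ordinal q_gt0).
have free : free_coords R G idx by exact: hat_free_coords.
have SE v : S (\row_k v k) <-> forall z : R[i], 0 <= complex.Re z ->
    (d <= \rank (eval_mx (coef_mx G idx v) z))%N.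
  have rowE : (fun k => (\row_k v k) 0 k) = v.
    by apply/boolp.funext => k; rewrite mxE.
  split=> [[P SP Pv] z z0|vS].
    by have := SP z z0; rewrite hat_polyE Pv rowE.
  exists (@of_coords R p q n_ m_ g (\row_k v k)); last exact: of_coordsK.
  by move=> z z0; rewrite hat_polyE of_coordsK rowE; apply: vS.
rewrite -(hat_degree_eq0 g hns hms _ _ n__gt0 m__gt0) leq_min genericP -/G.
split=> [[h [v0 hv0] hS]|[/andP[le_dn le_dm] cond]].
  have le_d : (d <= n)%N && (d <= m)%N.
    (* The rank at the single point 0 already bounds [d] by both dimensions. *)
    have /SE/(_ 0) := hS _ hv0; rewrite lexx => /(_ isT) dr.
    by rewrite (leq_trans dr (rank_leq_row _)) (leq_trans dr (rank_leq_col _)).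
  split=> //; apply: boolp.contrapT => /boolp.not_orP[/boolp.contrapT[dn nm]].
  move=> /boolp.existsNP[a /boolp.existsNP[b /eqP Gab]].
  (* Identifying the dimensions makes the matrix square, as [rank_defect_dense] requires. *)
  subst n m; rewrite -lt0n in Gab.
  have [v [x [hv x0]]] := rank_defect_dense free Gab hv0.
  by rewrite ltnNge => /negP; apply; apply: (SE v).1 (hS v hv) _ _.
have [h [v0 hv0] hP] : exists2 h : {mpoly R[_]}, exists v, h.@[v] != 0 &
    forall v z, h.@[v] != 0 -> (d <= \rank (eval_mx (coef_mx G idx v) z))%N.
  have [lt_dm|ge_dm] := ltnP d m; first exact: rank_generic_wide.
  have [lt_dn|ge_dn] := ltnP d n; first exact: rank_generic_tall.
  case: cond => [[]|]; last exact: rank_generic_const.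
  have dn : d = n by apply/eqP; rewrite eqn_leq le_dn.
  by split=> //; rewrite -dn; apply/eqP; rewrite eqn_leq le_dm.
exists h; first by exists v0.
by move=> v hv; apply/SE => z _; apply: hP.
Qed.
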